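(* If $F$ is a random continuous function, then the measure $\lambda\circ F^{-1}$ induced by $F$ is not a random measure.
   Context: $\lambda$ is the uniform (Lebesgue) measure on $2^\omega$; random continuous functions are total, so $\lambda\circ F^{-1}$ is a Borel probability measure on $2^\omega$. Martin-Löf randomness of $x\in n^\omega$ is with respect to the uniform measure $\lambda_n$: $x$ is Martin-Löf random if $x\notin\bigcap_iU_i$ for every uniformly $\Sigma^0_1$ sequence $(U_i)$ of open subsets of $n^\omega$ with $\lambda_n(U_i)\le2^{-i}$. Random continuous functions: let $\sigma_0=\epsilon,\sigma_1=0,\sigma_2=1,\dots$ be the length-lexicographic enumeration of $2^{<\omega}$. For $x\in3^\omega$ label node $\sigma_i$ ($i\ge1$) by $\ell_x(\sigma_i)=x(i-1)$, and let $F_x(y)$ be the sequence obtained from $\ell_x(y\restriction1),\ell_x(y\restriction2),\dots$ by deleting all $2$'s (undefined if only finitely many entries remain). $F$ is a random continuous function if $F=F_x$ for some Martin-Löf random $x\in3^\omega$. Random measures: fix a computable bijection $\langle\cdot,\cdot\rangle:\omega^2\to\omega$. For $x\in2^\omega$ let its $n$-th column $x_n\in2^\omega$ be $x_n(k)=x(\langle n,k\rangle)$, identified with the real $\sum_kx_n(k)2^{-(k+1)}\in[0,1]$. Then $\mu_x$ is the unique Borel probability measure on $2^\omega$ with $\mu_x(\llbracket\sigma_n0\rrbracket)=x_n\cdot\mu_x(\llbracket\sigma_n\rrbracket)$ for all $n$. A measure $\mu$ is a random measure if $\mu=\mu_x$ for some Martin-Löf random $x\in2^\omega$. *)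

(* Defs.v *)
From HB Require Import structures.
From mathcomp Require Import all_boot all_order all_algebra.
From mathcomp Require Import all_classical all_reals.

Set Implicit Arguments.
Unset Strict Implicit.
Unset Printing Implicit Defensive.

Import Order.TTheory GRing.Theory Num.Theory.

Inductive code : Type :=
| CZero : code
| CSucc : code
| CProj : nat -> code
| CComp : code -> seq code -> code
| CPrec : code -> code -> code
| CMu   : code -> code.

Inductive evalc : code -> seq nat -> nat -> Prop :=
| ev_zero v : evalc CZero v 0
| ev_succ n v : evalc CSucc (n :: v) n.+1
| ev_proj i v : i < size v -> evalc (CProj i) v (nth 0 v i)
| ev_comp f gs v ws y :
    evalcs gs v ws -> evalc f ws y -> evalc (CComp f gs) v y
| ev_prec0 g h v y : evalc g v y -> evalc (CPrec g h) (0 :: v) y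
| ev_precS g h n v r y :
    evalc (CPrec g h) (n :: v) r -> evalc h (n :: r :: v) y ->
    evalc (CPrec g h) (n.+1 :: v) y
| ev_mu f v n :
    evalc f (n :: v) 0 ->
    (forall m, m < n -> exists k, evalc f (m :: v) k.+1) ->
    evalc (CMu f) v n
with evalcs : seq code -> seq nat -> seq nat -> Prop :=
| evs_nil v : evalcs [::] v [::]
| evs_cons g gs v y ys :
    evalc g v y -> evalcs gs v ys -> evalcs (g :: gs) v (y :: ys).

Definition ce_set (e : code) (n : nat) : Prop := exists y, evalc e [:: n] y.

Definition cpair (a b : nat) : nat := ((a + b) * (a + b).+1) %/ 2 + b.
Definition scode (s : seq nat) : nat := foldr (fun a c => (cpair a c).+1) 0 s.

(* Points of k^omega are x : nat -> nat (with values < k); finite     *)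
(* strings are s : seq nat; an open set is given by a set G of        *)
(* strings and denotes the union of the cylinders [[s]], s in G.      *)

Definition has_prefix (x : nat -> nat) (s : seq nat) : Prop :=
  forall j, j < size s -> x j = nth 0 s j.

Definition in_open (G : seq nat -> Prop) (x : nat -> nat) : Prop :=
  exists s, G s /\ has_prefix x s.

(* For a finite list S of strings: L = maximal length, and the number of
   strings t of length L over k extending some element of S; the uniform
   measure of the finite union of cylinders is  fin_count k S / k^L. *)
Definition fin_len (S : seq (seq nat)) : nat := foldr maxn 0 (map size S).

Definition fin_count (k : nat) (S : seq (seq nat)) : nat :=
  #|[set t : (fin_len S).-tuple 'I_k |
      has (fun s => prefix s (map val t)) S]|.

(* lambda_k(U_G) <= 2^-i, using continuity of measure from below:
   every finite subunion has measure <= 2^-i. *)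
Definition open_meas_le_pow2 (k : nat) (G : seq nat -> Prop) (i : nat) : Prop :=
  forall S : seq (seq nat), (forall s, s \in S -> G s) ->
    fin_count k S * 2 ^ i <= k ^ fin_len S.

Definition lambda2_open {R : realType} (G : seq nat -> Prop) : R :=
  sup [set r : R | exists S : seq (seq nat), (forall s, s \in S -> G s) /\
        r = ((fin_count 2 S)%:R / (2 ^ fin_len S)%:R)%R].

(* A uniformly Sigma^0_1 sequence (U_i) is given by a c.e. set W_e:   *)
(* U_i is generated by the strings s with <i, code s> in W_e.        *)

Definition ML_gen (e : code) (i : nat) (s : seq nat) : Prop :=
  ce_set e (cpair i (scode s)).

Definition ML_random (k : nat) (x : nat -> nat) : Prop :=
  forall e : code,
    (forall i, open_meas_le_pow2 k (ML_gen e i) i) ->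
    ~ (forall i, in_open (ML_gen e i) x).

(* position of a binary string in the length-lexicographic enumeration
   sigma_0 = eps, sigma_1 = 0, sigma_2 = 1, sigma_3 = 00, ... *)
Definition bin_val (s : seq nat) : nat := foldl (fun v b => v.*2 + (b != 0)) 0 s.
Definition ll_index (s : seq nat) : nat := (2 ^ size s).-1 + bin_val s.

(* label of a nonempty node sigma_i (i >= 1): x (i - 1) *)
Definition label (x : nat -> nat) (s : seq nat) : nat := x (ll_index s).-1.

(* output produced by F_x along the finite path tau: labels of
   tau|1, ..., tau|(size tau) with all 2's deleted *)
Definition Fout (x : nat -> nat) (tau : seq nat) : seq nat :=
  flatten [seq (let l := label x (take j tau) in
                if l == 2 then [::] else [:: l]) | j <- iota 1 (size tau)].

(* F_x^{-1}([[sigma]]) is the open set generated by the tau whose output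
   extends sigma. *)
Definition Fpreim (x : nat -> nat) (sigma : seq nat) (tau : seq nat) : Prop :=
  prefix sigma (Fout x tau).

Definition induced_meas {R : realType} (x : nat -> nat) (sigma : seq nat) : R :=
  lambda2_open (Fpreim x sigma).

Definition column_real {R : realType} (y : nat -> nat) (n : nat) : R :=
  sup (range (fun m : nat =>
    (\sum_(k < m) (y (cpair n k))%:R / (2 ^ k.+1)%:R)%R : R)).

(* mu_y on cylinders, unfolding mu([[s 0]]) = y_n mu([[s]]) and
   mu([[s 1]]) = (1 - y_n) mu([[s]]) where s = sigma_n; mu([[eps]]) = 1.
   mu_rev works on the reversed string. *)
Fixpoint mu_rev {R : realType} (y : nat -> nat) (r : seq nat) : R :=
  match r with
  | [::] => 1%R
  | b :: r' =>
      ((if b == 0 then column_real y (ll_index (rev r'))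
        else 1 - column_real y (ll_index (rev r'))) * mu_rev y r')%R
  end.

Definition mu_cyl {R : realType} (y : nat -> nat) (s : seq nat) : R :=
  mu_rev y (rev s).

(* Main.v *)
Require Import Defs.
From HB Require Import structures.
From mathcomp Require Import all_boot all_order all_algebra.
From mathcomp Require Import all_classical all_reals.
From mathcomp Require Import zify ring lra.

(** The nodes of the tree all of whose nonempty initial segments are labelled 2
    form a branching process of mean 2/3.  The probability that it reaches depth
    2i is at most (4/9)^i <= 2^-i, so for random x it dies out at some depth n,
    and the first bit of F_x(y) depends only on the first n bits of y.  Hence the
    induced measure of [[0]] is a dyadic rational.  For the measure mu_y this value
    is the real coded by column 0 of y, so that column would be eventually
    constant, which is impossible when y is random. *)

Set Implicit Arguments.
Unset Strict Implicit.
Unset Printing Implicit Defensive.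

Import Order.TTheory GRing.Theory Num.Theory.

(** * Computable functions *)

Definition functional (e : Defs.code) : Prop :=
  forall v y z, evalc e v y -> evalc e v z -> y = z.

Lemma evalcs_functional gs v ys zs :
  List.Forall functional gs -> evalcs gs v ys -> evalcs gs v zs -> ys = zs.
Proof.
move=> Hgs; elim: Hgs ys zs => [|g {}gs Hg _ IH] ys zs Hy Hz.
  by inversion Hy; inversion Hz.
inversion Hy; inversion Hz; subst.
by congr (_ :: _); [apply: Hg; eassumption | apply: IH].
Qed.

(** The list of codes inside [CComp] is a nested occurrence, so the recursion is an explicit [fix]
    with an inner induction on that list. Determinism later identifies the value at which a halting
    search stops with the computed one. *)
Lemma evalc_functional : forall e, functional e.
Proof.
fix IH 1; case=> [||i|f gs|g h|f] v y z.
- by move=> Hy Hz; inversion Hy; inversion Hz.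
- by move=> Hy Hz; inversion Hy; subst; inversion Hz.
- by move=> Hy Hz; inversion Hy; inversion Hz.
- have IHgs : List.Forall functional gs.
    by elim: gs => [|g gs IHgs]; constructor.
  move=> Hy Hz; inversion Hy; inversion Hz; subst.
  have E : ws = ws0 by apply: evalcs_functional IHgs _ _; eassumption.
  by subst ws0; apply: (IH f); eassumption.
- case: v => [|n v] Hy Hz; first by inversion Hy.
  elim: n y z Hy Hz => [|n IHn] y z Hy Hz; inversion Hy; inversion Hz; subst.
    by apply: (IH g); eassumption.
  have E : r = r0 by apply: IHn.
  by subst r0; apply: (IH h); eassumption.
- move=> Hy Hz; inversion Hy as [| | | | | |f1 v1 n1 H0 Hlt]; subst.
  inversion Hz as [| | | | | |f2 v2 n2 H0' Hlt']; subst.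
  (* If the two results differ, [f] takes both the value 0 and a successor at the smaller one. *)
  case: (ltngtP y z) => // [/Hlt'|/Hlt] [k Hk].
    by have := IH f _ _ _ H0 Hk.
  by have := IH f _ _ _ H0' Hk.
Qed.

(** Functions live on all lists and the arity enters only as a length condition, so arguments can be
    written with [nth 0] and [drop] instead of tuples. *)
Definition computable (n : nat) (f : seq nat -> nat) : Prop :=
  exists e, forall v, size v = n -> evalc e v (f v).

Lemma eq_computable n f g :
  (forall v, size v = n -> f v = g v) -> computable n f -> computable n g.
Proof. by move=> fg [e He]; exists e => v Hv; rewrite -fg //; apply: He. Qed.

Lemma computable_nth n i : i < n -> computable n (fun v => nth 0 v i).
Proof. by move=> Hi; exists (CProj i) => v Hv; apply: ev_proj; rewrite Hv. Qed.

Lemma computable_comp n f (gs : seq (seq nat -> nat)) :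
  computable (size gs) f -> List.Forall (computable n) gs ->
  computable n (fun v => f [seq g v | g <- gs]).
Proof.
move=> [e He] Hgs.
suff [es Hes] : exists es, forall v, size v = n ->
    evalcs es v [seq g v | g <- gs].
  by exists (CComp e es) => v Hv; apply: ev_comp (Hes v Hv) (He _ _); rewrite size_map.
elim: Hgs => [|g {He}gs [d Hd] _ [es Hes]]; first by exists [::] => v _; constructor.
by exists (d :: es) => v Hv; constructor; [apply: Hd | apply: Hes].
Qed.

Lemma computable_app1 n (f : nat -> nat) a :
  computable 1 (fun v => f (nth 0 v 0)) -> computable n a ->
  computable n (fun v => f (a v)).
Proof. by move=> Hf Ha; apply: (computable_comp (gs := [:: a]) Hf); do !constructor. Qed.

Lemma computable_app2 n (f : nat -> nat -> nat) a b :
  computable 2 (fun v => f (nth 0 v 0) (nth 0 v 1)) ->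
  computable n a -> computable n b -> computable n (fun v => f (a v) (b v)).
Proof.
by move=> Hf Ha Hb; apply: (computable_comp (gs := [:: a; b]) Hf); do !constructor.
Qed.

Lemma computable_app3 n (f : nat -> nat -> nat -> nat) a b c :
  computable 3 (fun v => f (nth 0 v 0) (nth 0 v 1) (nth 0 v 2)) ->
  computable n a -> computable n b -> computable n c ->
  computable n (fun v => f (a v) (b v) (c v)).
Proof.
by move=> Hf Ha Hb Hc; apply: (computable_comp (gs := [:: a; b; c]) Hf); do !constructor.
Qed.

Lemma computable_reindex n ks f :
  all (fun k => k < n) ks -> computable (size ks) f ->
  computable n (fun v => f [seq nth 0 v k | k <- ks]).
Proof.
move=> Hks Hf.
have := @computable_comp n f [seq (fun v => nth 0 v k) | k <- ks].
rewrite size_map => /(_ Hf) H; apply: eq_computable (H _) => [v _|].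
  by rewrite -map_comp.
elim: ks Hks {Hf H} => [|k ks IH] /=; first by constructor.
by case/andP=> Hk /IH; constructor => //; apply: computable_nth.
Qed.

(** Weakening: recursions and sums bind their index in front of the outer variables, so outer terms
    reappear behind a [drop]. *)
Lemma computable_drop n m f :
  computable n f -> computable (m + n) (fun v => f (drop m v)).
Proof.
move=> Hf; have := @computable_reindex (m + n) (iota m n) f.
rewrite size_iota => H; apply: eq_computable (H _ Hf) => [v Hv|].
  congr (f _); apply: (@eq_from_nth _ 0) => [|i].
    by rewrite size_map size_iota size_drop Hv addKn.
  rewrite size_map size_iota => Hi.
  by rewrite (nth_map 0) ?size_iota // nth_iota // nth_drop.
by apply/allP => k; rewrite mem_iota => /andP[].
Qed.

Lemma computable_const n c : computable n (fun=> c).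
Proof.
elim: c => [|c IH]; first by exists CZero => v _; constructor.
apply: (computable_app1 (f := S) _ IH); exists CSucc => -[|a [|]] //= _.
by constructor.
Qed.

Lemma computable_succ n a : computable n a -> computable n (fun v => (a v).+1).
Proof.
apply: computable_app1; exists CSucc => -[|b [|]] //= _; by constructor.
Qed.

Lemma computable_rec n g m (h : nat -> nat -> seq nat -> nat) :
  computable n g -> computable n m ->
  computable n.+2 (fun w => h (nth 0 w 0) (nth 0 w 1) (drop 2 w)) ->
  computable n (fun v => nat_rect (fun=> nat) (g v) (fun j r => h j r v) (m v)).
Proof.
move=> [eg Hg] Hm [eh Hh].
have Hrec : computable n.+1 (fun w => nat_rect (fun=> nat) (g (drop 1 w))
    (fun j r => h j r (drop 1 w)) (nth 0 w 0)).
  exists (CPrec eg eh) => -[|a v] //= [Hv]; rewrite drop0.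
  elim: a => [|a IH] /=; first by constructor; apply: Hg.
  apply: ev_precS IH _.
  by have := Hh (a :: nat_rect (fun=> nat) (g v) (fun j r => h j r v) a :: v);
    rewrite /= drop0 Hv; apply.
have := @computable_comp n _ (m :: [seq (fun v => nth 0 v k) | k <- iota 0 n]).
rewrite /= size_map size_iota => /(_ _ Hrec) H.
apply: eq_computable (H _) => [v Hv|].
  rewrite /= drop0 -map_comp.
  suff -> : map ((fun g : seq nat -> nat => g v) \o (fun k v => nth 0 v k)) (iota 0 n) = v by [].
  by rewrite -Hv -[RHS](mkseq_nth 0).
constructor=> //.
have : {in iota 0 n, forall k, k < n} by move=> k; rewrite mem_iota.
elim: (iota 0 n) => [|k ks IH] Hks /=; constructor.
  by apply/computable_nth/Hks/mem_head.
by apply: IH => j Hj; apply: Hks; rewrite in_cons Hj orbT.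
Qed.

Lemma computable_add n a b :
  computable n a -> computable n b -> computable n (fun v => a v + b v).
Proof.
apply: computable_app2.
apply: eq_computable (computable_rec (n := 2) (h := fun _ r _ => r.+1)
  (computable_nth (i := 0) _) (computable_nth (i := 1) _) _) => // [v _|].
  by elim: (nth 0 v 1) => [|j /= ->]; rewrite ?addn0 ?addnS.
by apply/computable_succ/computable_nth.
Qed.

Lemma computable_sum n m (f : nat -> seq nat -> nat) :
  computable n m ->
  computable n.+1 (fun w => f (nth 0 w 0) (drop 1 w)) ->
  computable n (fun v => \sum_(j < m v) f j v).
Proof.
move=> Hm Hf.
apply: eq_computable (computable_rec (h := fun j r v => r + f j v)
  (computable_const n 0) Hm _) => [v _|].
  elim: (m v) => [|j /= ->]; first by rewrite big_ord0.
  by rewrite big_ord_recr.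
apply: computable_add; first exact: computable_nth.
(* The summand must not see the accumulator, which is variable 1 of the recursion step; the index
   list [0 :: iota 2 n] skips it. *)
have H := @computable_reindex n.+2 (0 :: iota 2 n) _ _.
rewrite /= size_iota in H.
apply: eq_computable (H _ _ Hf) => [[|a [|b v]] //= [Hv]|].
  rewrite !drop0; congr (f _ _); apply: (@eq_from_nth _ 0) => [|i].
    by rewrite size_map size_iota.
  rewrite size_map size_iota => Hi.
  by rewrite (nth_map 0) ?size_iota // nth_iota.
by apply/allP => k; rewrite mem_iota => /andP[].
Qed.

Lemma computable_mul n a b :
  computable n a -> computable n b -> computable n (fun v => a v * b v).
Proof.
apply: computable_app2.
apply: eq_computable (computable_sum (n := 2) (m := fun v => nth 0 v 0)
  (f := fun _ v => nth 0 v 1) _ _) => [v _||]; last 2 first.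
- exact: computable_nth.
- by apply: (@computable_drop 2 1 (fun v => nth 0 v 1)); apply: computable_nth.
by rewrite sum_nat_const card_ord.
Qed.

Lemma computable_pred n a : computable n a -> computable n (fun v => (a v).-1).
Proof.
apply: computable_app1.
apply: eq_computable (computable_rec (n := 1) (m := fun v => nth 0 v 0)
  (h := fun j _ _ => j) (computable_const 1 0) _ _) => [v _||].
- by case: (nth 0 v 0).
- exact: computable_nth.
- exact: computable_nth.
Qed.

Lemma computable_iter n f a m :
  computable 1 (fun v => f (nth 0 v 0)) -> computable n a -> computable n m ->
  computable n (fun v => iter (m v) f (a v)).
Proof.
move=> Hf Ha Hm.
apply: eq_computable (computable_rec (h := fun _ r _ => f r) Ha Hm _) => [v _|].
  by elim: (m v) => //= j ->.
by apply: computable_app1 => //; apply: computable_nth.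
Qed.

Lemma computable_sub n a b :
  computable n a -> computable n b -> computable n (fun v => a v - b v).
Proof.
move=> Ha Hb; apply: eq_computable (computable_iter (f := predn) _ Ha Hb) => [v _|].
  by elim: (b v) => [|j /= ->]; rewrite ?subn0 ?subnS.
by apply/computable_pred/computable_nth.
Qed.

Lemma computable_half n a : computable n a -> computable n (fun v => (a v)./2).
Proof.
apply: computable_app1.
(* The recursion is [j.+1./2 = j - j./2]. *)
apply: eq_computable (computable_rec (n := 1) (m := fun v => nth 0 v 0)
  (h := fun j r _ => j - r) (computable_const 1 0) _ _) => [v _||].
- by elim: (nth 0 v 0) => //= j ->; lia.
- exact: computable_nth.
- by apply: computable_sub; apply: computable_nth.
Qed.

Lemma computable_expn n c a : computable n a -> computable n (fun v => c ^ a v).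
Proof.
move=> Ha.
apply: eq_computable (computable_iter (f := muln c) _ (computable_const n 1) Ha) => [v _|].
  by elim: (a v) => [|j /= ->]; rewrite ?expn0 ?expnS.
by apply: computable_mul; [apply: computable_const | apply: computable_nth].
Qed.

Lemma computable_eq n a b :
  computable n a -> computable n b -> computable n (fun v => a v == b v : nat).
Proof.
move=> Ha Hb.
apply: eq_computable (_ : computable n (fun v => 1 - ((a v - b v) + (b v - a v)))).
  by move=> v _; case: eqP => /=; lia.
do !(apply: computable_sub || apply: computable_add) => //; exact: computable_const.
Qed.

Lemma computable_cpair n a b :
  computable n a -> computable n b -> computable n (fun v => cpair (a v) (b v)).
Proof.
move=> Ha Hb; apply: computable_add => //.
apply: eq_computable (_ : computable n (fun v => ((a v + b v) * (a v + b v).+1)./2)).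
  by move=> v _; rewrite -divn2.
apply/computable_half/computable_mul; first exact: computable_add.
by apply/computable_succ/computable_add.
Qed.

(** * Injectivity and inversion of the pairing function *)

Lemma cpair_inj a b c d : cpair a b = cpair c d -> a = c /\ b = d.
Proof.
rewrite /cpair !divn2.
have T n : (n.+1 * n.+2)./2 = (n * n.+1)./2 + n.+1.
  by rewrite mulSn mulnS; lia.
(* Pairs of sum [m] get codes from the [m]-th triangular number up to that number plus [m], hence
   below the next triangular number: the code determines the sum. *)
have mono m n : m < n -> (m * m.+1)./2 + m < (n * n.+1)./2.
  elim: n => // n IH; rewrite T ltnS leq_eqVlt => /orP[/eqP->|/IH]; lia.
case: (ltngtP (a + b) (c + d)) => [/mono|/mono|E]; last by rewrite E; lia.
all: lia.
Qed.

Lemma cpair_ge a b : a <= cpair a b /\ b <= cpair a b.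
Proof.
rewrite /cpair divn2; have : a + b <= ((a + b) * (a + b).+1)./2 + b.
  case: (a + b) => // n; suff : n.+1 <= (n.+1 * n.+2)./2 by lia.
  by rewrite mulnS; lia.
by lia.
Qed.

(* The bounded sums make the projections total (0 off the range of [cpair]), so
   surjectivity of [cpair] is not needed. *)
Definition cfst (n : nat) : nat :=
  \sum_(a < n.+1) \sum_(b < n.+1) a * (cpair a b == n).
Definition csnd (n : nat) : nat :=
  \sum_(a < n.+1) \sum_(b < n.+1) b * (cpair a b == n).

(** By injectivity a single term survives, and it lies in range because [cpair] dominates both
    arguments. *)
Lemma sum_cpair (f : nat -> nat -> nat) a b :
  \sum_(i < (cpair a b).+1) \sum_(j < (cpair a b).+1)
     f i j * (cpair i j == cpair a b) = f a b.
Proof.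
have [Ha Hb] := cpair_ge a b.
rewrite (bigD1 (Ordinal (Ha : a < (cpair a b).+1))) //=.
rewrite (bigD1 (Ordinal (Hb : b < (cpair a b).+1))) //= eqxx muln1.
rewrite !big1 ?addn0 // => [i Hi|j Hj].
  rewrite big1 // => j _; case: eqP => [/cpair_inj[E _]|]; last by rewrite muln0.
  by case/eqP: Hi; apply: val_inj.
case: eqP => [/cpair_inj[_ E]|]; last by rewrite muln0.
by case/eqP: Hj; apply: val_inj.
Qed.

Lemma cpairKl a b : cfst (cpair a b) = a.
Proof. exact: (sum_cpair (fun a _ => a)). Qed.

Lemma cpairKr a b : csnd (cpair a b) = b.
Proof. exact: (sum_cpair (fun _ b => b)). Qed.

(** Computability of [f] is assumed under substitution at every arity because the summand sits below
    two bound indices. *)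
Lemma computable_sum_cpair n f a :
  (forall m (b c : seq nat -> nat), computable m b -> computable m c ->
    computable m (fun v => f (b v) (c v))) ->
  computable n a ->
  computable n (fun v => \sum_(i < (a v).+1) \sum_(j < (a v).+1)
     f i j * (cpair i j == a v)).
Proof.
move=> Hf Ha; apply: (computable_sum (m := fun v => (a v).+1)
  (f := fun i v => \sum_(j < (a v).+1) f i j * (cpair i j == a v))).
  exact: computable_succ.
apply: (computable_sum (n := n.+1) (m := fun v => (a (drop 1 v)).+1)
  (f := fun j w => f (nth 0 w 0) j * (cpair (nth 0 w 0) j == a (drop 1 w)))).
  by apply: computable_succ; apply: (@computable_drop n 1 a).
have H0 : computable n.+2 (fun v => nth 0 (drop 1 v) 0).
  by apply: (@computable_drop n.+1 1 (fun v => nth 0 v 0)); apply: computable_nth.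
have H1 : computable n.+2 (fun v => a (drop 1 (drop 1 v))).
  apply: (@computable_drop n.+1 1 (fun v => a (drop 1 v))).
  exact: (@computable_drop n 1 a).
apply: computable_mul; first by apply: Hf => //; apply: computable_nth.
apply: computable_eq => //; apply: computable_cpair => //; exact: computable_nth.
Qed.

Lemma computable_cfst n a : computable n a -> computable n (fun v => cfst (a v)).
Proof. by apply: (computable_sum_cpair (f := fun a _ => a)). Qed.

Lemma computable_csnd n a : computable n a -> computable n (fun v => csnd (a v)).
Proof. by apply: (computable_sum_cpair (f := fun _ b => b)). Qed.

Lemma ce_set_computable f : computable 1 f ->
  exists e, forall n, ce_set e n <-> f [:: n] = 0.
Proof.
(* The search variable is discarded by [CProj 1], so the search stops at 0 if [f] vanishes at [n]
   and diverges otherwise. *)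
move=> [e He]; exists (CMu (CComp e [:: CProj 1])) => n.
have Hev m : evalc (CComp e [:: CProj 1]) [:: m; n] (f [:: n]).
  apply: (@ev_comp _ _ _ [:: n]); last by apply: He.
  by constructor; [apply: (@ev_proj 1 [:: m; n]) | constructor].
split=> [[y Hy]|fn0].
  inversion Hy as [| | | | | |g w m H0 Hlt]; subst.
  exact: evalc_functional (Hev _) H0.
by exists 0; apply: ev_mu => //; have := Hev 0; rewrite fn0.
Qed.

(** * Reading letters off coded strings *)

Definition ctl (c : nat) : nat := csnd c.-1.

(** The remaining code is compared with the code it would have if its head were [c]. Past the end of
    the string the remaining code is 0, which is no successor, so the test fails there. *)
Definition cnth_eq (c d p : nat) : nat :=
  iter p ctl d == (cpair c (ctl (iter p ctl d))).+1.

Lemma iter_ctl_scode s p : iter p ctl (scode s) = scode (drop p s).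
Proof.
have tl0 : ctl 0 = 0.
  by rewrite /ctl /csnd big1 // => i _; rewrite big1 // => j _; rewrite ord1.
elim: p s => [|p IH] s; first by rewrite drop0.
rewrite iterSr; case: s => [|a s] /=.
  by rewrite tl0 (IH [::]).
by rewrite /ctl /= cpairKr IH.
Qed.

Lemma cnth_eqP c s p :
  reflect (p < size s /\ nth 0 s p = c) (cnth_eq c (scode s) p == 1).
Proof.
rewrite /cnth_eq iter_ctl_scode.
case: (ltnP p (size s)) => Hp; last first.
  by rewrite drop_oversize //=; constructor=> -[].
rewrite (drop_nth 0) //= /ctl /= cpairKr eqSS eqb1.
apply: (iffP eqP) => [/cpair_inj[]//|[_ ->]] //.
Qed.

Lemma computable_cnth_eq n c a b :
  computable n a -> computable n b -> computable n (fun v => cnth_eq c (a v) (b v)).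
Proof.
move=> Ha Hb.
have Hd : computable n (fun v => iter (b v) ctl (a v)).
  by apply: computable_iter => //; apply/computable_csnd/computable_pred/computable_nth.
apply: computable_eq => //; apply/computable_succ/computable_cpair.
  exact: computable_const.
exact/computable_csnd/computable_pred.
Qed.

(** * Martin-Löf tests given by prescribed values at computable positions *)

(** Fixing [N] distinct coordinates leaves at most [k ^ (L - N)] tuples; the product form avoids the
    subtraction. A position beyond [L] makes the set empty. *)
Lemma card_tuples_fixed_positions k L N (c : nat) (pos : nat -> nat) :
  {in gtn N &, injective pos} ->
  #|[set t : L.-tuple 'I_k | [forall j : 'I_N,
      (pos j < L) && (nth 0 (map val t) (pos j) == c)]]| * k ^ N <= k ^ L.
Proof.
move=> pos_inj; set A := [set t | _].
case: (boolP [forall j : 'I_N, pos j < L]) => [/forallP posL|]; last first.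
  case/forallPn => j HjL; suff -> : A = finset.set0 by rewrite cards0.
  apply/finset.setP => t; rewrite !inE; apply/negbTE/forallPn; exists j.
  by rewrite (negbTE HjL).
pose P := [set Ordinal (posL j) | j : 'I_N]%SET.
have cardP : #|P| = N.
  rewrite card_imset ?card_ord // => i j [] /pos_inj E; apply: val_inj; apply: E; exact: ltn_ord.
pose F (i : 'I_L) := [pred a : 'I_k | (i \in P) ==> (val a == c)].
have le_family : #|A| <= #|family F|.
  rewrite -(card_imset (f := fun t : L.-tuple 'I_k => [ffun i => tnth t i])); last first.
    by move=> t u /ffunP E; apply: eq_from_tnth => i; have := E i; rewrite !ffunE.
  apply/subset_leq_card/fintype.subsetP => _ /imsetP[t + ->]; rewrite inE => /forallP tA.
  apply/familyP => i; rewrite ffunE inE; apply/implyP => /imsetP[j _ ->].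
  have /andP[_] := tA j.
  set o := Ordinal _; rewrite (tnth_nth (tnth t o)).
  by rewrite -[pos j]/(val o) (nth_map (tnth t o)) // size_tuple ltn_ord.
apply: (leq_trans (leq_mul le_family (leqnn _))).
rewrite card_family foldrE big_map big_enum /=.
(* The factor [k ^ N] is distributed over the coordinates in [P]: such a coordinate contributes at
   most 1 times [k], any other one [k] times 1. *)
rewrite -[in k ^ N]cardP -prod_nat_const [X in _ * X]big_mkcond -big_split /=.
rewrite -[L in k ^ L]card_ord -prod_nat_const; apply: leq_prod => i _.
rewrite /F; case: (i \in P) => /=; last first.
  by rewrite muln1 (eq_card (B := 'I_k)) ?card_ord.
rewrite -[leqRHS]mul1n leq_mul2r; apply/orP; right.
apply/card_le1P => a; rewrite unfold_in /= => /eqP ac b.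
by rewrite !unfold_in /= -ac.
Qed.

(** Union bound: each of the [B] patterns has measure at most [k ^ -N]. *)
Lemma open_meas_le_pow2_union k (G : seq nat -> Prop) i B N (c : nat)
    (pos : nat -> nat -> nat) :
  0 < k -> B * 2 ^ i <= k ^ N ->
  (forall h, h < B -> {in gtn N &, injective (pos h)}) ->
  (forall s, G s -> exists2 h, h < B &
     forall j, j < N -> pos h j < size s /\ nth 0 s (pos h j) = c) ->
  open_meas_le_pow2 k G i.
Proof.
move=> k0 HB pos_inj HG S HS.
set L := fin_len S.
pose A h := [set t : L.-tuple 'I_k | [forall j : 'I_N,
      (pos h j < L) && (nth 0 (map val t) (pos h j) == c)]]%SET.
have le_sum : fin_count k S <= \sum_(h < B) #|A h|.
  have leU : #|(\bigcup_(h < B) A h)%SET| <= \sum_(h < B) #|A h|.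
    elim/big_rec2: _ => [|h m U _ IH]; first by rewrite cards0.
    by rewrite (leq_trans (leq_card_setU _ _).1) // leq_add2l.
  apply: leq_trans leU; apply/subset_leq_card/fintype.subsetP => t; rewrite inE.
  case/hasP => s /HS /HG[h hB Hs] /prefixP[u tE].
  apply/finset.bigcupP; exists (Ordinal hB) => //; rewrite inE.
  apply/forallP => j; have [Hj <-] := Hs j (ltn_ord j).
  rewrite tE nth_cat Hj eqxx andbT.
  have := congr1 size tE; rewrite size_map size_tuple size_cat /L => ->.
  exact: ltn_addr.
have {}le_sum : fin_count k S * k ^ N <= B * k ^ L.
  apply: (leq_trans (leq_mul le_sum (leqnn _))).
  rewrite big_distrl /= -[B in leqRHS]card_ord -sum_nat_const.
  by apply: leq_sum => h _; apply: card_tuples_fixed_positions; apply: pos_inj.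
have kN : 0 < k ^ N by rewrite expn_gt0 k0.
rewrite -(leq_pmul2r kN) mulnAC.
apply: leq_trans (leq_mul le_sum (leqnn (2 ^ i))) _.
by rewrite mulnAC mulnC leq_mul2l HB orbT.
Qed.

(** The [i]-th test set consists of the strings that, for some [h < B i], carry [c] at all positions
    [pos i h j] with [j < N i]. A random [x] must escape one of these sets. Both uses of randomness
    below are instances. *)
Lemma ML_random_avoids k (c : nat) x (B N : nat -> nat) (pos : nat -> nat -> nat -> nat) :
  0 < k -> (forall i, B i * 2 ^ i <= k ^ N i) ->
  (forall i h, h < B i -> {in gtn (N i) &, injective (pos i h)}) ->
  computable 1 (fun v => B (nth 0 v 0)) ->
  computable 1 (fun v => N (nth 0 v 0)) ->
  computable 3 (fun v => pos (nth 0 v 0) (nth 0 v 1) (nth 0 v 2)) ->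
  ML_random k x ->
  exists i, forall h, h < B i -> exists2 j, j < N i & x (pos i h j) <> c.
Proof.
move=> k0 HB pos_inj cB cN cpos Hx.
(* [miss i d h] counts the positions of pattern [h] that the string coded by [d] either does not
   reach or fills with a letter other than [c]. *)
pose miss i d h := \sum_(j < N i) (1 - cnth_eq c d (pos i h j)).
(* [reject n = 0] iff [n] codes a pair (i, s) with s in the i-th test set. *)
pose reject n := 1 - \sum_(h < B (cfst n)) (1 - miss (cfst n) (csnd n) h).
have creject : computable 1 (fun v => reject (nth 0 v 0)).
  apply: computable_sub; first exact: computable_const.
  apply: (computable_sum (n := 1) (m := fun v => B (cfst (nth 0 v 0)))
    (f := fun h v => 1 - miss (cfst (nth 0 v 0)) (csnd (nth 0 v 0)) h)).
    by apply: computable_app1 => //; apply/computable_cfst/computable_nth.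
  apply: computable_sub; first exact: computable_const.
  have v01 : computable 2 (fun v => nth 0 (drop 1 v) 0).
    by apply: (@computable_drop 1 1 (fun v => nth 0 v 0)); apply: computable_nth.
  apply: (computable_sum (n := 2) (m := fun v => N (cfst (nth 0 (drop 1 v) 0)))
    (f := fun j v => 1 - cnth_eq c (csnd (nth 0 (drop 1 v) 0))
       (pos (cfst (nth 0 (drop 1 v) 0)) (nth 0 v 0) j))).
    by apply: computable_app1 => //; apply/computable_cfst.
  have v02 : computable 3 (fun v => nth 0 (drop 1 (drop 1 v)) 0).
    exact: (@computable_drop 2 1 (fun v => nth 0 (drop 1 v) 0)).
  apply: computable_sub; first exact: computable_const.
  apply: computable_cnth_eq; first exact/computable_csnd.
  apply: computable_app3 => //; first exact/computable_cfst.
    by apply: (@computable_drop 2 1 (fun v => nth 0 v 0)); apply: computable_nth.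
  exact: computable_nth.
have [e He] := ce_set_computable creject.
have genP i s : ML_gen e i s <-> exists2 h, h < B i &
    forall j, j < N i -> pos i h j < size s /\ nth 0 s (pos i h j) = c.
  rewrite /ML_gen He /= /reject cpairKl cpairKr; split.
    move=> /eqP; rewrite subn_eq0 lt0n sum_nat_eq0 => /forallPn[h].
    rewrite subn_eq0 -ltnNge ltnS leqn0 sum_nat_eq0 => /forallP Hj.
    exists h => // j jN; have := Hj (Ordinal jN); rewrite subn_eq0 /= => Hc.
    by apply/cnth_eqP; rewrite eqn_leq Hc andbT /cnth_eq leq_b1.
  move=> [h hB Hj]; apply/eqP; rewrite subn_eq0 lt0n sum_nat_eq0.
  apply/forallPn; exists (Ordinal hB); rewrite subn_eq0 -ltnNge ltnS leqn0 sum_nat_eq0.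
  apply/forallP => j; apply/implyP => _; rewrite subn_eq0.
  by have /cnth_eqP/eqP -> := Hj j (ltn_ord j).
have Htest i : open_meas_le_pow2 k (ML_gen e i) i.
  apply: open_meas_le_pow2_union (HB i) _ _ => // [|s /genP]; last by apply.
  exact: pos_inj.
apply: contrapT => Hn; apply: (Hx e Htest) => i.
have [h hB Hh] : exists2 h, h < B i & forall j, j < N i -> x (pos i h j) = c.
  apply: contrapT => Hh; apply: Hn; exists i => h hB.
  apply: contrapT => Hj; apply: Hh; exists h => // j jN.
  by apply: contrapT => E; apply: Hj; exists j.
(* Membership needs a finite witness: the prefix of [x] of length [M] reaches every position of the
   pattern. *)
pose M := \max_(j < N i) (pos i h j).+1.
have HM j : j < N i -> pos i h j < M.
  by move=> jN; apply: (leq_bigmax (F := fun j : 'I__ => (pos i h j).+1) (Ordinal jN)).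
exists (mkseq x M); split; last by move=> j; rewrite size_mkseq => Hj; rewrite nth_mkseq.
apply/genP; exists h => // j jN; rewrite size_mkseq nth_mkseq; last exact: HM.
by split; [apply: HM | apply: Hh].
Qed.

(** * The measure induced by a random function *)

Lemma bin_val_lt s : bin_val s < 2 ^ size s.
Proof.
elim/last_ind: s => // s b IH; rewrite /bin_val foldl_rcons -/(bin_val s) size_rcons expnS.
by case: (b != 0) => /=; lia.
Qed.

(* [(ll_index s).+1] is the binary number 1s, so halving it drops the last bit. *)
Lemma heap_index s : (ll_index s).+1 = 2 ^ size s + bin_val s.
Proof. by rewrite /ll_index -addSn prednK ?expn_gt0. Qed.

Lemma heap_index_parent s b : (ll_index (rcons s b)).+1./2 = (ll_index s).+1.
Proof.
rewrite !heap_index /bin_val foldl_rcons -/(bin_val s) size_rcons expnS.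
by case: (b != 0) => /=; lia.
Qed.

Lemma heap_index_ancestor s j : j <= size s ->
  iter j half (ll_index s).+1 = (ll_index (take (size s - j) s)).+1.
Proof.
elim: j => [|j IH] Hj; first by rewrite subn0 take_size.
rewrite iterS IH; last exact: ltnW.
have -> : size s - j = (size s - j.+1).+1 by lia.
by rewrite (take_nth 0) ?heap_index_parent //; lia.
Qed.

Lemma iter_half_divn j n : iter j half n = n %/ 2 ^ j.
Proof.
by elim: j => [|j IH]; rewrite ?divn1 // iterS IH -divn2 -divnMA expnSr.
Qed.

(** The node with heap index [m] has its label at position [m - 2] of [x]. For [j < n] the iterates
    stay at least 2, so the subtraction is exact and each halving strictly decreases. *)
Lemma iter_half_inj n m : 2 ^ n <= m ->
  {in gtn n &, injective (fun j => iter j half m - 2)}.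
Proof.
move=> Hm; have ge2 j : j < n -> 2 <= iter j half m.
  move=> jn; rewrite iter_half_divn leq_divRL ?expn_gt0 // -expnS.
  by apply: leq_trans Hm; rewrite leq_exp2l.
have decr a b : a < b -> b < n -> iter b half m < iter a half m.
  elim: b => // b IH; rewrite ltnS leq_eqVlt => /orP[/eqP->|ab] bn.
    by have := ge2 b (ltnW bn); rewrite iterS; lia.
  apply: leq_trans (IH ab (ltnW bn)); rewrite iterS.
  by have := ge2 b (ltnW bn); lia.
move=> a b; rewrite !unfold_in /= => an bn; have := ge2 a an; have := ge2 b bn.
by case: (ltngtP a b) => // [/decr/(_ bn)|/decr/(_ an)]; lia.
Qed.

Lemma random_paths_leave_two x : ML_random 3 x ->
  exists n, forall t, size t = n ->
    exists m, [/\ 0 < m, m <= n & label x (take m t) <> 2].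
Proof.
move=> Hx.
(* Here [h] is the binary value of a node at depth [2i], so [2 ^ (i + i) + h] is its heap index;
   halving [j] times gives its [j]-th ancestor. There are [4 ^ i] such paths, each with [2i] labels
   prescribed to be 2. *)
have [||||||i Hi] := @ML_random_avoids 3 2 x (fun i => 2 ^ (i + i)) (fun i => i + i)
  (fun i h j => iter j half (2 ^ (i + i) + h) - 2) _ _ _ _ _ _ Hx => //.
(* The measure bound amounts to [8 ^ i <= 9 ^ i]. *)
- move=> i; rewrite -!expnD; have -> : i + i + i = 3 * i by lia.
  have -> : i + i = 2 * i by lia.
  by rewrite !expnM; case: i => // i; rewrite leq_exp2r.
- by move=> i h _; apply: iter_half_inj; rewrite leq_addr.
- by apply/computable_expn/computable_add; apply: computable_nth.
- by apply: computable_add; apply: computable_nth.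
- apply: computable_sub; last exact: computable_const.
  apply: computable_iter; try exact: computable_nth.
    exact/computable_half/computable_nth.
  apply: computable_add; try exact: computable_nth.
  by apply/computable_expn/computable_add; apply: computable_nth.
exists (i + i) => t tn; have := Hi (bin_val t).
rewrite -{1}tn => /(_ (bin_val_lt t))[j jn].
rewrite -{1}tn -heap_index heap_index_ancestor ?tn ?(ltnW jn) // subSS subn1 => Hj.
by exists (i + i - j); split => //; lia.
Qed.

(** * Finite outputs and the preimage of a one-letter cylinder *)

Lemma Fout_cat x t u : exists r, Fout x (t ++ u) = Fout x t ++ r.
Proof.
rewrite /Fout size_cat iotaD map_cat flatten_cat; eexists; congr (flatten _ ++ _).
apply/eq_in_map => j; rewrite mem_iota => /andP[_]; rewrite add1n ltnS => Hj.
by rewrite takel_cat.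
Qed.

Lemma Fout_neq0 x t m : 0 < m -> m <= size t -> label x (take m t) <> 2 ->
  Fout x t <> [::].
Proof.
move=> m0 mt Hm E.
have : label x (take m t) \in Fout x t.
  apply/flatten_mapP; exists m; first by rewrite mem_iota m0 add1n ltnS.
  by rewrite /= (introF eqP Hm) inE.
by rewrite E.
Qed.

Lemma prefix_head (b : nat) s r : s <> [::] -> prefix [:: b] (s ++ r) = prefix [:: b] s.
Proof. by case: s => //= a s _; rewrite !prefix0s. Qed.

Lemma fin_len_constant n S :
  S <> [::] -> (forall s, s \in S -> size s = n) -> fin_len S = n.
Proof.
case: S => // s S _; elim: S s => [|s' S IH] s HS.
  by rewrite /fin_len /= maxn0 HS ?mem_head.
rewrite -[fin_len _]/(maxn (size s) (fin_len (s' :: S))) IH.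
  by rewrite HS ?mem_head // maxnn.
by move=> r rS; apply: HS; rewrite in_cons rS orbT.
Qed.

Section InducedMeasure.
Variables (x : nat -> nat) (n b : nat).
Hypothesis leaves_two : forall t, size t = n ->
  exists m, [/\ 0 < m, m <= n & label x (take m t) <> 2].

(** Every path of length [n] has already produced output, so the preimage of [[:: b]] is the clopen
    set given by these strings. *)
Let level := [set t : n.-tuple 'I_2 | prefix [:: b] (Fout x (map val t))]%SET.

(** Both measures are compared at the common length [fin_len S + n]: a string of that length
    extending a member of [S] also extends a member of [level]. *)
Lemma fin_count_Fpreim_le S : (forall s, s \in S -> Fpreim x [:: b] s) ->
  fin_count 2 S * 2 ^ n <= #|level| * 2 ^ fin_len S.
Proof.
move=> HS; set L := fin_len S.
pose A := [set t : L.-tuple 'I_2 | has (fun s => prefix s (map val t)) S]%SET.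
have cardX k (C : {set k.-tuple 'I_2}) m :
    #|finset.setX C [set: m.-tuple 'I_2]%SET| = #|C| * 2 ^ m.
  by rewrite cardsX cardsT card_tuple card_ord.
rewrite -[fin_count 2 S]/#|A| -!cardX.
have szw (t : L.-tuple 'I_2) (u : n.-tuple 'I_2) : size (t ++ u) = L + n.
  by rewrite size_cat !size_tuple.
have sz1 (t : L.-tuple 'I_2) (u : n.-tuple 'I_2) : size (take n (t ++ u)) == n.
  by rewrite size_takel ?szw // leq_addl.
have sz2 (t : L.-tuple 'I_2) (u : n.-tuple 'I_2) : size (drop n (t ++ u)) == L.
  by rewrite size_drop szw addnK.
pose f (p : L.-tuple 'I_2 * n.-tuple 'I_2) := (Tuple (sz1 p.1 p.2), Tuple (sz2 p.1 p.2)).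
(* [f] cuts the concatenation [t ++ u] after [n] letters instead of after [L]. *)
rewrite -(card_imset (f := f)); last first.
  move=> [t u] [t' u'] [E1 E2].
  have /eqP : val t ++ val u = val t' ++ val u'.
    by rewrite -(cat_take_drop n (t ++ u)) E1 E2 cat_take_drop.
  by rewrite eqseq_cat ?size_tuple // => /andP[/eqP/val_inj-> /eqP/val_inj->].
apply/subset_leq_card/fintype.subsetP => _ /imsetP[[t u] + ->].
rewrite !inE /= andbT => /hasP[s sS /prefixP[r tE]].
have [m [m0 mn Hm]] : exists m, [/\ 0 < m, m <= n &
    label x (take m (map val (take n (t ++ u)))) <> 2].
  by apply: leaves_two; rewrite size_map (eqP (sz1 t u)).
have ne := Fout_neq0 m0 _ Hm.
have [q Eq] := Fout_cat x (map val (take n (t ++ u))) (map val (drop n (t ++ u))).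
(* The output of the first [n] letters is nonempty, so it alone decides whether the whole output
   starts with [b]. *)
rewrite -(prefix_head b q) -?Eq; last first.
  by apply: ne; rewrite size_map (eqP (sz1 t u)).
rewrite -map_cat cat_take_drop map_cat tE -catA.
have [q' ->] := Fout_cat x s (r ++ map val u).
by have := HS s sS; rewrite /Fpreim => /prefixP[w ->]; rewrite -catA prefix_prefix.
Qed.

Local Open Scope ring_scope.

Lemma induced_meas_dyadic (R : realType) :
  exists M : nat, induced_meas x [:: b] = M%:R / (2 ^ n)%:R :> R.
Proof.
exists #|level|; rewrite /induced_meas /lambda2_open.
set E := [set r | _]%classic.
have pow0 k : 0 < (2 ^ k)%:R :> R by rewrite ltr0n expn_gt0.
have ubE : ubound E (#|level|%:R / (2 ^ n)%:R).
  move=> r [S [HS ->]]; rewrite ler_pdivrMr // mulrAC ler_pdivlMr //.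
  by rewrite -!natrM ler_nat fin_count_Fpreim_le.
have Elevel : E (#|level|%:R / (2 ^ n)%:R).
  (* The supremum is attained by [level] itself. The empty case is separate because [fin_len] of the
     empty list is 0 rather than [n]. *)
  have [l0|[t0 t0l]] := finset.set_0Vmem level.
    exists [::]; split => //; rewrite l0 cards0.
    have -> : fin_count 2 [::] = 0%N by apply: eq_card0 => t; rewrite inE.
    by rewrite !mul0r.
  pose S := [seq map (@nat_of_ord 2) (val t) | t <- enum level].
  have sizeS s : s \in S -> size s = n.
    by case/mapP => t _ ->; rewrite size_map size_tuple.
  have HS (t : n.-tuple 'I_2) : (map (@nat_of_ord 2) (val t) \in S) = (t \in level).
    rewrite -mem_enum.
    apply: (mem_map (f := fun t : n.-tuple 'I_2 => map (@nat_of_ord 2) (val t))).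
    by move=> u v /(inj_map val_inj)/val_inj.
  have lenS : fin_len S = n.
    have : S != [::] by apply/eqP => E0; have := HS t0; rewrite E0 t0l.
    by move/eqP => S0; apply: fin_len_constant.
  exists S; split.
    by move=> s /mapP[t + ->]; rewrite mem_enum inE.
  congr (_%:R / _%:R); last by rewrite lenS.
  rewrite /fin_count lenS; apply: eq_card => t; rewrite [RHS]inE -HS.
  apply/idP/hasP => [tS|[s sS]]; first by exists (map val (val t)) => //; apply: prefix_refl.
  rewrite prefixE (sizeS _ sS) take_oversize => [/eqP->//|].
  by rewrite size_map size_tuple.
apply/eqP; rewrite eq_le; apply/andP; split.
  by apply: ge_sup => //; exists (#|level|%:R / (2 ^ n)%:R).
by apply: ub_le_sup => //; exists (#|level|%:R / (2 ^ n)%:R).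
Qed.

End InducedMeasure.

(** * Columns coding a dyadic rational *)

Section DyadicColumn.
Variables (R : realType) (y : nat -> nat) (n : nat).
Hypothesis y2 : forall i, y i < 2.

Local Open Scope ring_scope.

Let psum (m : nat) : R := \sum_(k < m) (y (cpair n k))%:R / (2 ^ k.+1)%:R.

Let psumS m : psum m.+1 = psum m + (y (cpair n m))%:R / (2 ^ m.+1)%:R.
Proof. by rewrite /psum big_ord_recr. Qed.

Let pow0 k : 0 < (2 ^ k)%:R :> R.
Proof. by rewrite ltr0n expn_gt0. Qed.

Let powS k : (2 ^ k.+1)%:R = 2 * (2 ^ k)%:R :> R.
Proof. by rewrite expnS natrM. Qed.

(** Each bit is at most 1, so the right ends of the dyadic intervals decrease; they therefore bound
    all partial sums and the column real. *)
Let psum_tail m d : psum (m + d) + (2 ^ (m + d))%:R^-1 <= psum m + (2 ^ m)%:R^-1.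
Proof.
elim: d => [|d IH]; first by rewrite addn0.
apply: le_trans IH; rewrite addnS psumS -addrA lerD2l.
have y1 : (y (cpair n (m + d)))%:R <= 1 :> R by rewrite lern1 -ltnS.
rewrite -[X in _ + X]mul1r -mulrDl ler_pdivrMr // powS mulrCA mulVf ?gt_eqF //.
by lra.
Qed.

Let psum_le m d : psum m <= psum (m + d).
Proof.
elim: d => [|d IH]; first by rewrite addn0.
by apply: le_trans IH _; rewrite addnS psumS lerDl divr_ge0.
Qed.

Let psum_ub m m' : psum m' <= psum m + (2 ^ m)%:R^-1.
Proof.
apply: le_trans (psum_le m' m) _; rewrite addnC; apply: le_trans (psum_tail m m').
by rewrite lerDl invr_ge0.
Qed.

(* [excess m] is the real whose binary expansion is column [n] shifted by [m]; if
   the column codes a dyadic rational it becomes 0 or 1 and then stays constant. *)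
Let excess m : R := (2 ^ m)%:R * (column_real y n - psum m).

Let excess_bounds m : 0 <= excess m <= 1.
Proof.
have ubm : ubound (range psum) (psum m + (2 ^ m)%:R^-1) by move=> _ [k _ <-].
apply/andP; split.
  rewrite mulr_ge0 // subr_ge0 /column_real; apply: ub_le_sup; last by exists m.
  by exists (psum m + (2 ^ m)%:R^-1).
rewrite /excess mulrC -ler_pdivlMr // mul1r lerBlDl.
by apply: ge_sup => //; exists (psum 0), 0%N.
Qed.

Let excessS m : excess m.+1 = 2 * excess m - (y (cpair n m))%:R.
Proof.
rewrite /excess psumS powS; have := pow0 m => /lt0r_neq0 p.
by field.
Qed.

(** With this, a column real of denominator [2 ^ N] has an integral [excess N]. *)
Let psum_int m : exists a : nat, (2 ^ m)%:R * psum m = a%:R :> R.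
Proof.
elim: m => [|m [a IH]]; first by exists 0%N; rewrite /psum big_ord0 mulr0.
exists (2 * a + y (cpair n m))%N; rewrite psumS mulrDr natrD natrM -IH powS.
have := pow0 m => /lt0r_neq0 p; by field.
Qed.

Lemma dyadic_column_eventually_constant (M N : nat) :
  column_real y n = M%:R / (2 ^ N)%:R :> R ->
  exists c : nat, forall k, y (cpair n (N + k)) = c.
Proof.
move=> Ey; have [a Ha] := psum_int N.
have EN : excess N = M%:R - a%:R.
  by rewrite /excess mulrBr Ha Ey mulrC divfK // gt_eqF.
(* An integer between 0 and 1 is 0 or 1. *)
have [c c2 ENc] : exists2 c : nat, (c < 2)%N & excess N = c%:R.
  have := excess_bounds N; rewrite EN subr_ge0 ler_nat lerBlDr => /andP[aM].
  rewrite nat1r ler_nat => Ma; exists (M - a)%N; first by lia.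
  by rewrite natrB.
exists c; suff H k : excess (N + k) = c%:R -> y (cpair n (N + k)) = c.
  move=> k; apply: (H); elim: k => [|k IH]; first by rewrite addn0.
  by rewrite addnS excessS IH (H k IH); ring.
(* A digit other than [c] would make the next excess [2c - y] equal to -1 or 2, outside the unit
   interval; the digit [c] reproduces the excess [c]. *)
move=> Ek; have := excess_bounds (N + k).+1; rewrite excessS Ek.
have := y2 (cpair n (N + k)).
case: c c2 {EN ENc Ek} => [|[|]] // _; case: (y _) => [|[|]] //= _ /andP[l u]; exfalso; lra.
Qed.

End DyadicColumn.

(** The test has a single pattern per level: the [i] entries of the column from [N] on all equal
    [c], a condition of measure at most [2 ^ -i]. *)
Lemma random_column_not_eventually_constant y n N c :
  ML_random 2 y -> ~ forall k, y (cpair n (N + k)) = c.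
Proof.
move=> Hy Hc.
have [||||||i /(_ 0 erefl)[j _]] := @ML_random_avoids 2 c y (fun=> 1) id
  (fun _ _ j => cpair n (N + j)) _ _ _ _ _ _ Hy => //.
- by move=> i; rewrite mul1n.
- by move=> i h _ a b _ _ /cpair_inj[_ /addnI].
- exact: computable_const.
- exact: computable_nth.
- apply: computable_cpair; first exact: computable_const.
  by apply: computable_add; [apply: computable_const | apply: computable_nth].
Qed.

Theorem theorem6p13 (R : realType) (x : nat -> nat) :
  (forall i, x i < 3) -> ML_random 3 x ->
  ~ (exists y : nat -> nat,
        (forall i, y i < 2) /\ ML_random 2 y /\
        (forall sigma : seq nat, all (fun b => b < 2) sigma ->
           mu_cyl (R := R) y sigma = induced_meas (R := R) x sigma)).
Proof.
move=> _ /random_paths_leave_two[n Hn] [y [y2 [Hy /(_ [:: 0] isT)]]].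
have [M ->] := induced_meas_dyadic 0 Hn R.
(* The empty string has index 0, so the cylinder [[:: 0]] receives exactly the real of column 0. *)
rewrite /mu_cyl /= mulr1 => /(dyadic_column_eventually_constant y2)[c Hc].
exact: random_column_not_eventually_constant Hy Hc.
Qed.
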